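(* Let $X$ be a complex infinite-dimensional reflexive Banach space with a monotone Schauder basis $(e_n)_{n\ge 0}$. Then a typical $T\in(\mathcal{P}_1(X),\mathrm{SOT}^* )$ does not satisfy the AAB criterion. That is, the set of all $T\in\mathcal{P}_1(X)$ that do not satisfy the AAB criterion is comeager in $(\mathcal{P}_1(X),\mathrm{SOT}^* )$.
   Context: Let $X$ be a complex Banach space with Schauder basis $(e_n)_{n\ge0}$ and biorthogonal functionals $(e_n^* )_{n\ge0}$. The basis is monotone if the canonical projections $P_N$ onto $[e_0,\dots,e_N]$ satisfy $\|P_N\|\le 1$ for all $N\ge 0$. A vector $x\in X$ is positive ($x\ge0$) if $\langle e_n^*,x\rangle\ge 0$ for all $n\ge0$. A bounded operator $T$ on $X$ is positive if $Tx\ge0$ for every $x\ge0$. $\mathcal{P}_1(X)$ is the set of bounded positive operators on $X$ with $\|T\|\le1$. $\mathrm{SOT}^*$ (Strong* Operator Topology): $T_i\to T$ iff $\|T_ix-Tx\|\to0$ for every $x\in X$ and $\|T_i^*x^*-T^*x^*\|\to0$ for every $x^*\in X^*$. A set is comeager if it contains a dense $G_\delta$ subset of the space (here $(\mathcal P_1(X),\mathrm{SOT}^* )$ is a Polish, hence Baire, space); a property is typical if the set of operators having it is comeager. An operator $A$ is quasinilpotent at $x$ if $\lim_{n\to\infty}\|A^nx\|^{1/n}=0$. A positive operator $T$ on $X$ satisfies the AAB (Abramovich–Aliprantis–Burkinshaw) criterion if there exists a non-zero bounded positive operator $A$ on $X$ with $AT=TA$ which is quasinilpotent at some non-zero positive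 vector of $X$. *)

(* Defs.v *)
From HB Require Import structures.
From mathcomp Require Import all_boot all_order all_algebra.
From mathcomp Require Import complex.
From mathcomp Require Import all_classical all_reals all_analysis.
From mathcomp Require Import borel_hierarchy.
Set Implicit Arguments.
Unset Strict Implicit.
Unset Printing Implicit Defensive.
Import Order.TTheory GRing.Theory Num.Theory.
Import numFieldNormedType.Exports.
Local Open Scope classical_set_scope.
Local Open Scope ring_scope.
Local Open Scope complex_scope.

(** Complex scalars are [R[i]] for [R : realType]; seen as a normed space over
    itself this type is written [R[i]^o].  On a [normedModType R[i]] the norm is [R[i]]-valued; [rnorm] is its value
    as an element of [R]. *)
Definition rnorm (R : realType) (V : normedModType R[i]) (x : V) : R :=
  complex.Re `|x|.

Section rnorm_theory.
Context (R : realType) (V : normedModType R[i]).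
Implicit Types x y : V.

Lemma rnormE x : (rnorm x)%:C = `|x|.
Proof.
have := normr_ge0 x; rewrite /rnorm; move: (`|x| : R[i]) => [a b].
by rewrite lecE/= => /andP[/eqP -> _].
Qed.

Lemma rnorm_ge0 x : 0 <= rnorm x.
Proof. by rewrite -lecR rnormE normr_ge0. Qed.

Lemma rnorm_eq0 x : rnorm x = 0 -> x = 0.
Proof. by move=> x0; apply/normr0_eq0; rewrite -rnormE x0. Qed.

Lemma rnorm0 : rnorm (0 : V) = 0.
Proof. by rewrite /rnorm normr0. Qed.

Lemma ler_rnormD x y : rnorm (x + y) <= rnorm x + rnorm y.
Proof. by rewrite -lecR rmorphD /= !rnormE ler_normD. Qed.

Lemma rnormZ (a : R[i]) x : rnorm (a *: x) = rnorm (a : R[i]^o) * rnorm x.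
Proof. by apply: complexI; rewrite rmorphM /= !rnormE normrZ. Qed.

End rnorm_theory.

(** ** Bounded operators *)

Section bounded_operator.
Context (R : realType) (V W : normedModType R[i]).

(** [bounded_operator] is the predicate, [bop V W] (below) the space of bounded
    linear operators, normed by the operator norm. *)
Definition bounded_operator : {pred V -> W} := fun f =>
  `[< linear f /\ exists M : R, forall x, rnorm (f x) <= M * rnorm x >].

Lemma bounded_operator_submod : GRing.submod_closed bounded_operator.
Proof.
split.
- apply/asboolP; split; first by move=> a x y; rewrite scaler0 addr0.
  by exists 0 => x; rewrite mul0r rnorm0.
- move=> a f g /asboolP[lf [M fM]] /asboolP[lg [N gN]]; apply/asboolP; split.
    move=> b x y; rewrite /= !fctE lf lg !scalerDr !scalerA (mulrC a b).
    by rewrite addrACA.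
  exists (rnorm (a : R[i]^o) * M + N) => x; rewrite /= !fctE.
  rewrite (le_trans (ler_rnormD _ _))// mulrDl lerD// rnormZ -mulrA.
  by rewrite ler_wpM2l// rnorm_ge0.
Qed.

HB.instance Definition _ := GRing.isSubmodClosed.Build _ _ bounded_operator
  bounded_operator_submod.

Record bop := Bop { bop_fun :> V -> W; _ : bop_fun \in bounded_operator }.

HB.instance Definition _ := [isSub for bop_fun].
HB.instance Definition _ := [Choice of bop by <:].
HB.instance Definition _ := [SubChoice_isSubLmodule of bop by <:].

Lemma bop_linear (T : bop) : linear T.
Proof. by case: T => f /= /asboolP[]. Qed.

HB.instance Definition _ (T : bop) :=
  GRing.isLinear.Build R[i] V W _ T (@bop_linear T).

Lemma bopP (S T : bop) : S = T <-> S =1 T.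
Proof. by split=> [->//|ST]; apply/val_inj/funext. Qed.

Lemma bop_bounded (T : bop) : exists M : R, forall x, rnorm (T x) <= M * rnorm x.
Proof. by case: T => f /= /asboolP[]. Qed.

Definition ropnorm (T : bop) : R :=
  sup [set rnorm (T x) | x in [set x | rnorm x <= 1]].

Lemma ropnorm_has_sup (T : bop) :
  has_sup [set rnorm (T x) | x in [set x | rnorm x <= 1]].
Proof.
split; first by exists (rnorm (T 0)), 0 => //=; rewrite rnorm0.
have [M TM] := bop_bounded T; exists `|M| => _ [x /= x1 <-].
rewrite (le_trans (TM x))// (le_trans (ler_wpM2r (rnorm_ge0 x) (ler_norm M)))//.
by rewrite ler_piMr.
Qed.

Lemma ropnorm_ub (T : bop) x : rnorm x <= 1 -> rnorm (T x) <= ropnorm T.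
Proof. by move=> x1; apply: (sup_upper_bound (ropnorm_has_sup T)); exists x. Qed.

Lemma ropnorm_le (T : bop) (M : R) :
  (forall x, rnorm x <= 1 -> rnorm (T x) <= M) -> ropnorm T <= M.
Proof.
move=> TM; apply: ge_sup; first by have [] := ropnorm_has_sup T.
by move=> _ [x /= x1 <-]; exact: TM.
Qed.

Lemma ropnorm_ge0 (T : bop) : 0 <= ropnorm T.
Proof.
by rewrite (le_trans (rnorm_ge0 (T 0)))// ropnorm_ub// rnorm0.
Qed.

Lemma rnorm_bop (T : bop) x : rnorm (T x) <= ropnorm T * rnorm x.
Proof.
have [->|x0] := eqVneq x 0; first by rewrite linear0 !rnorm0 mulr0.
have nx0 : 0 < rnorm x.
  rewrite lt_neqAle rnorm_ge0 andbT eq_sym.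
  by apply: contra x0 => /eqP/rnorm_eq0->.
have nV : rnorm (((rnorm x)^-1)%:C : R[i]^o) = (rnorm x)^-1.
  by rewrite /rnorm ger0_norm// lecR invr_ge0 rnorm_ge0.
have := @ropnorm_ub T (((rnorm x)^-1)%:C *: x).
rewrite linearZ/= !rnormZ nV mulVf ?gt_eqF// => /(_ (lexx _)).
by rewrite mulrC ler_pdivrMr.
Qed.

Definition opnorm (T : bop) : R[i] := (ropnorm T)%:C.

Lemma opnormD S T : opnorm (S + T) <= opnorm S + opnorm T.
Proof.
rewrite /opnorm -rmorphD lecR; apply: ropnorm_le => x x1.
by rewrite (le_trans (ler_rnormD _ _))// lerD// ropnorm_ub.
Qed.

Lemma opnormZ (a : R[i]) T : opnorm (a *: T) = `|a| * opnorm T.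
Proof.
rewrite /opnorm -(rnormE (a : R[i]^o)) -rmorphM; congr (_%:C).
apply/eqP; rewrite eq_le; apply/andP; split.
  apply: ropnorm_le => x x1.
  by rewrite rnormZ ler_wpM2l// ?rnorm_ge0// ropnorm_ub.
have [->|a0] := eqVneq a 0; first by rewrite rnorm0 mul0r ropnorm_ge0.
have na0 : 0 < rnorm (a : R[i]^o).
  rewrite lt_neqAle rnorm_ge0 andbT eq_sym.
  by apply: contra a0 => /eqP/(@rnorm_eq0 _ R[i]^o)->.
rewrite -ler_pdivlMl//; apply: ropnorm_le => x x1.
by rewrite ler_pdivlMl// -rnormZ; exact: (@ropnorm_ub (a *: T)).
Qed.

Lemma opnorm_eq0 T : opnorm T = 0 -> T = 0.
Proof.
move=> /complexI T0; apply/bopP => x; apply: rnorm_eq0; apply/eqP.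
by rewrite eq_le rnorm_ge0 andbT (le_trans (rnorm_bop T x))// T0 mul0r.
Qed.

HB.instance Definition _ :=
  Lmodule_isNormed.Build R[i] bop opnormD opnormZ opnorm_eq0.

Lemma bop_normE (T : bop) :
  `|T| = (sup [set rnorm (T x) | x in [set x | rnorm x <= 1]])%:C.
Proof. by []. Qed.

End bounded_operator.
Arguments bounded_operator {R} V W _.

Section operations.
Context (R : realType).
Implicit Types U V W : normedModType R[i].

Lemma bop_comp_subproof U V W (S : bop V W) (T : bop U V) :
  S \o T \in bounded_operator U W.
Proof.
apply/asboolP; split; first by move=> a x y /=; rewrite !linearP.
exists (ropnorm S * ropnorm T) => x /=.
rewrite (le_trans (rnorm_bop _ _))// -mulrA ler_wpM2l ?ropnorm_ge0//.
exact: rnorm_bop.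
Qed.

Definition bop_comp U V W (S : bop V W) (T : bop U V) : bop U W :=
  Bop (bop_comp_subproof S T).

Definition dual V := bop V R[i]^o.

(** The Banach space adjoint, [f |-> f \o T]. *)
Definition adjoint V W (T : bop V W) : dual W -> dual V :=
  fun f => bop_comp f T.

Lemma rank_one_subproof V W (f : dual V) (y : W) :
  (fun x => (f x : R[i]) *: y) \in bounded_operator V W.
Proof.
apply/asboolP; split=> [a x z|]; first by rewrite linearP scalerDl scalerA.
exists (ropnorm f * rnorm y) => x.
by rewrite rnormZ mulrAC ler_wpM2r ?rnorm_ge0// rnorm_bop.
Qed.

Definition rank_one V W (f : dual V) (y : W) : bop V W :=
  Bop (rank_one_subproof f y).

Lemma bidual_eval_subproof V (x : V) :
  (fun f : dual V => f x) \in bounded_operator (dual V) R[i]^o.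
Proof.
apply/asboolP; split=> [a f g //|].
by exists (rnorm x) => f; rewrite mulrC; exact: rnorm_bop.
Qed.

Definition bidual_eval V (x : V) : dual (dual V) := Bop (bidual_eval_subproof x).

Definition reflexive_space V := range (@bidual_eval V) = setT.

Definition infinite_dimensional V :=
  forall n (v : 'I_n -> V), exists x, forall c : 'I_n -> R[i],
    x <> \sum_(i < n) c i *: v i.

End operations.

(** ** Schauder bases *)

Section schauder.
Context (R : realType) (X : normedModType R[i]).
Implicit Types (e : X^nat) (es : (dual X)^nat).

Definition schauder_basis e :=
  forall x : X, exists! a : R[i]^nat,
    \sum_(0 <= k < n) a k *: e k @[n --> \oo] --> x.

(** A biorthogonal sequence in the dual is unique when [e] is a basis: it is the
    sequence of coordinate functionals. *)
Definition biorthogonal e es := forall m n, es m (e n) = (m == n)%:R.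

Definition basis_proj e es (N : nat) : bop X X :=
  \sum_(n < N.+1) rank_one (es n) (e n).

Definition monotone_basis e es := forall N, `|basis_proj e es N| <= 1.

(** In [R[i]], [0 <= z] means that [z] is real and nonnegative. *)
Definition positive_vector es (x : X) := forall n, 0 <= (es n x : R[i]).

Definition positive_operator es (T : bop X X) :=
  forall x, positive_vector es x -> positive_vector es (T x).

Definition quasinilpotent_at (A : bop X X) (x : X) :=
  rnorm (iter n A x) `^ n%:R^-1 @[n --> \oo] --> (0 : R).

Definition satisfies_AAB es (T : bop X X) :=
  exists A : bop X X,
    [/\ A <> 0, positive_operator es A, bop_comp A T = bop_comp T A &
        exists x, [/\ x <> 0, positive_vector es x & quasinilpotent_at A x]].

End schauder.

(** ** The strong* operator topology *)

Section sot_star.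
Context (R : realType) (X : normedModType R[i]).

Definition sot_star_map (T : bop X X) :
    ({ptws X -> X} * {ptws dual X -> dual X})%type :=
  (T : X -> X, adjoint T).

(** The operators [bop X X] with the coarsest topology making [T |-> T x] and
    [T |-> adjoint T f] norm-continuous for all [x : X] and [f : dual X]; see
    [sot_star_cvgP] for the description of its convergence. *)
Definition sot_star : Type := initial_topology sot_star_map.
HB.instance Definition _ := Topological.on sot_star.

Lemma sot_star_cvgP (F : set_system sot_star) (T : sot_star) : Filter F ->
  F --> T <->
  (forall x : X, `|(S : bop X X) x - (T : bop X X) x| @[S --> F] --> (0 : R[i]^o))
  /\ (forall f : dual X,
      `|adjoint (S : bop X X) f - adjoint (T : bop X X) f| @[S --> F]
        --> (0 : R[i]^o)).
Proof.
move=> FF; pose m := sot_star_map.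
have cvgm : F --> T <-> m @ F --> m T.
  split=> [FT A mTA|FT A].
    apply: FT; have := @initial_continuous _ _ sot_star_map T _ mTA.
    by [].
  move=> [B [[C oC <-] mTC] CA]; apply: (filterS CA).
  by apply: FT; exact: open_nbhs_nbhs.
have cvgb (V : normedModType R[i]) (g : sot_star -> V) (l : V) :
    g @ F --> l <-> `|g S - l| @[S --> F] --> (0 : R[i]^o).
  by rewrite norm_cvg0P subr_cvg0.
rewrite cvgm; split=> [FmT|[FX FD]].
- split=> [x|f].
  + apply/(cvgb X (fun S : bop X X => S x) ((T : bop X X) x)).
    have FT : {ptws, (fun S => fst (m S)) @ F --> fst (m T)}.
      exact: (cvg_comp _ _ FmT cvg_fst).
    by move/pointwise_cvgP : FT => /(_ x).
  + apply/(cvgb (dual X) (fun S : bop X X => adjoint S f) (adjoint T f)).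
    have FT : {ptws, (fun S => snd (m S)) @ F --> snd (m T)}.
      exact: (cvg_comp _ _ FmT cvg_snd).
    by move/pointwise_cvgP : FT => /(_ f).
- have FT1 : {ptws, (fun S => fst (m S)) @ F --> fst (m T)}.
    apply/pointwise_cvgP => x.
    by apply/(cvgb X (fun S : bop X X => S x) ((T : bop X X) x)); exact: FX.
  have FT2 : {ptws, (fun S => snd (m S)) @ F --> snd (m T)}.
    apply/pointwise_cvgP => f.
    apply/(cvgb (dual X) (fun S : bop X X => adjoint S f) (adjoint T f)).
    exact: FD.
  exact: (cvg_pair FT1 FT2).
Qed.

Definition positive_contractions (es : (dual X)^nat) : set sot_star :=
  [set T : bop X X | positive_operator es T /\ `|T| <= 1].

End sot_star.

Definition comeager (T : topologicalType) (A : set T) :=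
  exists G : set T, [/\ Gdelta G, dense G & G `<=` A].

(* Main.v *)
Require Import Defs.
From HB Require Import structures.
From mathcomp Require Import all_boot all_order all_algebra.
From mathcomp Require Import complex.
From mathcomp Require Import all_classical all_reals all_analysis.
From mathcomp Require Import lra ring.
Set Implicit Arguments.
Unset Strict Implicit.
Unset Printing Implicit Defensive.
Import Order.TTheory GRing.Theory Num.Theory.
Import numFieldNormedType.Exports.
Local Open Scope classical_set_scope.
Local Open Scope ring_scope.
Local Open Scope complex_scope.

(** The reason why the theorem holds: an operator [T >= 0] all of whose matrix
    entries [es i (T (e j))] are nonzero never satisfies the AAB criterion, and
    among the positive contractions such operators form a dense G-delta set.

    Failure of the criterion ([positive_entries_not_AAB]).  Suppose that
    [A >= 0] is nonzero, commutes with [T], and is quasinilpotent at some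
    [x >= 0], [x <> 0].  Then [B = A T^2 = T A T] is positive, and it is still
    quasinilpotent at [x] because [B^n x = T^(2n) (A^n x)]
    ([quasinilpotent_at_comm]).  Since [A] has a positive entry and [T] has only
    positive ones, every entry of [T A T] is positive.  On the other hand, if
    the [m]-th coordinate [x_m] of [x] is nonzero, then
    [x_m * b_mm ^ n <= (B^n x)_m = O(|B^n x|)], so quasinilpotence at [x] forces
    [b_mm = 0] ([quasinilpotent_entry0]): a contradiction.

    Genericity.  For fixed [i] and [j], the condition [es i (T (e j)) <> 0] is
    open, since an entry is a continuous function of [T]; so the operators with
    no zero entry form a countable intersection of open sets.  This set is dense
    because it contains points of a segment issuing from any given operator: a
    suitably weighted sum of all matrix units is a positive contraction [K] with
    no zero entry ([positive_contraction_entries_exists]), and for every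
    positive contraction [T] the operators [(1 - t) T + t K], [0 < t <= 1], are
    positive contractions with no zero entry which converge to [T] as [t] tends
    to [0]. *)

(** * Convergence in terms of the real-valued norm *)

Lemma rnorm_realC (R : realType) (r : R) : rnorm (r%:C : R[i]^o) = `|r|.
Proof. by rewrite /rnorm normc_def/= expr0n addr0 sqrtr_sqr. Qed.

Section rnorm_topology.
Context (R : realType) (V : normedModType R[i]).
Implicit Types x y : V.

Lemma normE_lt x (r : R) : (`|x| < r%:C) = (rnorm x < r).
Proof. by rewrite -rnormE ltcR. Qed.

Lemma rnormN x : rnorm (- x) = rnorm x.
Proof. by rewrite /rnorm normrN. Qed.

Lemma ler_rnorm_sum (I : Type) (r : seq I) (P : pred I) (u : I -> V) :
  rnorm (\sum_(i <- r | P i) u i) <= \sum_(i <- r | P i) rnorm (u i).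
Proof.
elim/big_ind2 : _ => // [|x a y b xa yb]; first by rewrite rnorm0.
by rewrite (le_trans (ler_rnormD _ _))// lerD.
Qed.

Lemma gt0_complexP (z : R[i]) : 0 < z -> exists2 r : R, 0 < r & z = r%:C.
Proof.
case: z => a b; rewrite ltcE/= => /andP[/eqP-> a0].
by exists a.
Qed.

(** Since positive elements of [R[i]] are real, convergence can be tested with
    real tolerances. *)
Lemma cvg_rnormP (T : Type) (F : set_system T) {FF : Filter F}
    (u : T -> V) (l : V) :
  u @ F --> l <->
  forall eps : R, 0 < eps -> \forall t \near F, rnorm (l - u t) < eps.
Proof.
split=> [/cvgrPdist_lt ul eps eps0|ul].
  have /ul : 0 < eps%:C by rewrite ltcR.
  by apply: filterS => t; rewrite normE_lt.
apply/cvgrPdist_lt => _ /gt0_complexP[eps eps0 ->].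
by have := ul _ eps0; apply: filterS => t; rewrite normE_lt.
Qed.

Lemma cvg_rnorm (T : Type) (F : set_system T) {FF : Filter F}
    (u : T -> V) (l : V) :
  u @ F --> l -> rnorm (u t) @[t --> F] --> rnorm l.
Proof.
move=> /cvg_rnormP ul; apply/cvgrPdist_lt => eps /ul.
apply: filterS => t; apply: le_lt_trans.
have := ler_rnormD (l - u t) (u t); have := ler_rnormD (u t - l) l.
rewrite !subrK -(rnormN (u t - l)) opprB => h1 h2.
rewrite ler_norml; apply/andP; split; lra.
Qed.

End rnorm_topology.

Lemma bop_cvg (R : realType) (V W : normedModType R[i]) (T : bop V W)
    (S : Type) (F : set_system S) {FF : Filter F} (u : S -> V) (l : V) :
  u @ F --> l -> T (u s) @[s --> F] --> T l.
Proof.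
move=> /cvg_rnormP ul; apply/cvg_rnormP => eps eps0.
have c0 : 0 < ropnorm T + 1 by rewrite ltr_wpDl// ropnorm_ge0.
have /ul : 0 < eps / (ropnorm T + 1) by rewrite divr_gt0.
apply: filterS => s; rewrite -linearB ltr_pdivlMr//.
apply: le_lt_trans; rewrite (le_trans (rnorm_bop _ _))// mulrC.
by rewrite ler_wpM2l ?rnorm_ge0// lerDl.
Qed.

(** The order of [R[i]] is only partial, so the closedness of half-lines of a
    real field does not apply; but [z >= 0] means [z = |z|], and the norm is
    continuous. *)
Lemma cvg_ge0_complex (R : realType) (T : Type) (F : set_system T)
    {FF : ProperFilter F} (u : T -> R[i]^o) (l : R[i]^o) :
  u @ F --> l -> (forall t, 0 <= (u t : R[i])) -> 0 <= (l : R[i]).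
Proof.
move=> ul u0.
suff -> : l = (rnorm l)%:C by rewrite lecR rnorm_ge0.
apply: (cvg_unique (@norm_hausdorff _ R[i]^o) ul).
apply/cvg_rnormP => eps eps0.
have /cvgrPdist_lt ul_norm : rnorm (u t) @[t --> F] --> rnorm l.
  exact: cvg_rnorm.
have := ul_norm _ eps0; apply: filterS => t.
rewrite /= -{2}(ger0_norm (u0 t)) -(rnormE (u t)).
by rewrite -rmorphB rnorm_realC.
Qed.

(** * Absolutely convergent series of operators *)

Section absolutely_convergent_series.
Context (R : realType) (V : normedModType R[i]).
Context (W : completeNormedModType R[i]).

(** The series of norms dominates each series [T k x], which therefore converges
    in the complete space [W]; the pointwise sum inherits linearity and the
    bound [C] from the partial sums. *)
Lemma bop_series_exists (T : nat -> bop V W) (C : R) :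
  (forall n, \sum_(0 <= k < n) ropnorm (T k) <= C) ->
  exists K : bop V W, ropnorm K <= C /\
    forall x, \sum_(0 <= k < n) T k x @[n --> \oo] --> K x.
Proof.
move=> TC.
have T_cauchy : cauchy (series (fun k => ropnorm (T k)) @ \oo).
  apply/cauchy_cvgP; apply: nondecreasing_is_cvgn.
    by apply: nondecreasing_series => n _ _; exact: ropnorm_ge0.
  by exists C => _ [n _ <-]; exact: TC.
have Tx_cvg x : cvgn (series (fun k => T k x)).
  apply/cauchy_cvgP/cauchy_seriesP => _ /gt0_complexP[eps eps0 ->].
  have c0 : 0 < rnorm x + 1 by rewrite ltr_wpDl// rnorm_ge0.
  have /cauchy_seriesP T_tail := T_cauchy.
  have /T_tail : 0 < eps / (rnorm x + 1) by rewrite divr_gt0.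
  apply: filterS => -[m n] /=.
  rewrite normE_lt ltr_pdivlMr//; apply: le_lt_trans.
  rewrite (le_trans (ler_rnorm_sum _ _ _))// ger0_norm; last first.
    by rewrite sumr_ge0// => k _; exact: ropnorm_ge0.
  rewrite mulr_suml ler_sum// => k _; rewrite (le_trans (rnorm_bop _ _))//.
  by rewrite ler_wpM2l ?ropnorm_ge0// lerDl.
pose f x := limn (series (fun k => T k x)).
have fE x : \sum_(0 <= k < n) T k x @[n --> \oo] --> f x by exact: Tx_cvg.
have f_bound x : rnorm (f x) <= C * rnorm x.
  apply: (cvgr_to_le (cvg_rnorm (fE x))); apply: nearW => n.
  rewrite (le_trans (ler_rnorm_sum _ _ _))//.
  rewrite (@le_trans _ _ (\sum_(0 <= k < n) ropnorm (T k) * rnorm x))//.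
    by rewrite ler_sum// => k _; exact: rnorm_bop.
  by rewrite -mulr_suml ler_wpM2r ?rnorm_ge0.
have f_linear : linear f.
  move=> a x y; apply: (cvg_unique (@norm_hausdorff _ W) (fE _)).
  have -> : (fun n => \sum_(0 <= k < n) T k (a *: x + y)) =
      (fun n => a *: \sum_(0 <= k < n) T k x + \sum_(0 <= k < n) T k y).
    apply/funext => n; rewrite scaler_sumr -big_split.
    by apply: eq_bigr => k _; rewrite linearP.
  by apply: cvgD (fE y); apply: cvgZr; exact: fE.
have fP : f \in bounded_operator V W by apply/asboolP; split=> //; exists C.
exists (Bop fP); split=> //.
apply: ropnorm_le => x x1; rewrite (le_trans (f_bound x))// ler_piMr//.
by rewrite (le_trans _ (TC 0%N))// big_geq.
Qed.

End absolutely_convergent_series.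

(** * Local quasinilpotence *)

Section quasinilpotence.
Context (R : realType) (X : normedModType R[i]).
Implicit Types (A S : bop X X) (x : X).

(** Trades the [n]-th roots for geometric bounds, which are stable under the
    algebraic manipulations below. *)
Lemma quasinilpotent_atP A x :
  quasinilpotent_at A x <->
  forall eps : R, 0 < eps ->
    \forall n \near \oo, rnorm (iter n A x) <= eps ^+ n.
Proof.
split=> [/cvgrPdist_lt Ax eps /Ax|Ax].
  move=> Axe; near=> n.
  have n0 : (0 < n)%N by near: n; exact: nbhs_infty_gt.
  have : `|0 - rnorm (iter n A x) `^ n%:R^-1| < eps by near: n.
  rewrite sub0r normrN ger0_norm ?powR_ge0// => /ltW root_le.
  rewrite -[leLHS]powRr1 ?rnorm_ge0// -(@mulVf _ n%:R) ?pnatr_eq0 ?gt_eqF//.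
  rewrite powRrM powR_mulrn ?powR_ge0//.
  by rewrite lerXn2r// nnegrE ?(le_trans _ root_le)// powR_ge0.
apply/cvgrPdist_lt => eps eps0; near=> n.
have n0 : (0 < n)%N by near: n; exact: nbhs_infty_gt.
have : rnorm (iter n A x) <= (eps / 2) ^+ n.
  by near: n; apply: Ax; rewrite divr_gt0.
have eps2 : 0 <= eps / 2 by rewrite divr_ge0// ltW.
rewrite -powR_mulrn// => /(@ge0_ler_powR _ n%:R^-1 _ _ _).
rewrite -powRrM mulfV ?pnatr_eq0 ?gt_eqF// powRr1//.
rewrite !nnegrE rnorm_ge0 powR_ge0 invr_ge0 ler0n => /(_ isT isT isT) root_le.
rewrite sub0r normrN ger0_norm ?powR_ge0// (le_lt_trans root_le)//.
by rewrite ltr_pdivrMr// ltr_pMr// ltr1n.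
Unshelve. all: by end_near.
Qed.

Lemma iter_comm_bop A S n x : bop_comp A S = bop_comp S A ->
  iter n (bop_comp A S) x = iter n S (iter n A x).
Proof.
move=> /bopP AS; have ASn m y : A (iter m S y) = iter m S (A y).
  by elim: m => //= m <-; exact: (AS _).
by elim: n => //= n ->; exact: (ASn n.+1).
Qed.

Lemma rnorm_iter_bop A n x : rnorm (iter n A x) <= ropnorm A ^+ n * rnorm x.
Proof.
elim: n => [|n IHn] /=; first by rewrite mul1r.
rewrite (le_trans (rnorm_bop _ _))// exprS -mulrA.
by rewrite ler_wpM2l// ropnorm_ge0.
Qed.

(** Here [(A S)^n x = S^n (A^n x)], and [|S^n|] grows at most geometrically. *)
Lemma quasinilpotent_at_comm A S x : bop_comp A S = bop_comp S A ->
  quasinilpotent_at A x -> quasinilpotent_at (bop_comp A S) x.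
Proof.
move=> AS /quasinilpotent_atP Ax; apply/quasinilpotent_atP => eps eps0.
have c0 : 0 < ropnorm S + 1 by rewrite ltr_wpDl// ropnorm_ge0.
have /Ax : 0 < eps / (ropnorm S + 1) by rewrite divr_gt0.
apply: filterS => n; rewrite iter_comm_bop// exprMn exprVn.
rewrite ler_pdivlMr ?exprn_gt0// mulrC; apply: le_trans.
rewrite (le_trans (rnorm_iter_bop _ _ _))// ler_wpM2r ?rnorm_ge0//.
by rewrite lerXn2r ?nnegrE ?ropnorm_ge0 ?(ltW c0)// lerDl.
Qed.

End quasinilpotence.

(** * Positive operators and their matrix entries *)

Section positivity.
Context (R : realType) (X : completeNormedModType R[i]).
Context (e : nat -> X) (es : nat -> dual X).
Hypotheses (e_basis : schauder_basis e) (es_biorth : biorthogonal e es).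
Implicit Types (A S T : bop X X) (x : X).

Lemma basis_expansion x : \sum_(0 <= k < n) es k x *: e k @[n --> \oo] --> x.
Proof.
have [a [ax _]] := e_basis x.
suff aE k : es k x = a k by under eq_fun do under eq_bigr do rewrite aE.
have esx : es k (\sum_(0 <= j < n) a j *: e j) @[n --> \oo] --> es k x.
  exact: bop_cvg.
apply: (cvg_unique (@norm_hausdorff _ R[i]^o) esx).
apply: cvg_near_cst; exists k.+1 => // n /= kn.
rewrite linear_sum (bigD1_seq k) ?iota_uniq ?mem_index_iota//=.
rewrite linearZ /= es_biorth eqxx big1 ?addr0; first exact: mulr1.
by move=> j jk; rewrite linearZ /= es_biorth eq_sym (negbTE jk) scaler0.
Qed.

Lemma neq0_coordinate x : x <> 0 -> exists n, es n x != 0.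
Proof.
move=> x0; apply/not_existsP => xes; apply: x0.
apply: (cvg_unique (@norm_hausdorff _ X) (@basis_expansion x)).
apply: cvg_near_cst; apply: nearW => n; rewrite big1// => k _.
by have /negP := xes k; rewrite negbK => /eqP->; rewrite scale0r.
Qed.

Lemma neq0_bop_basis A : A <> 0 -> exists n, A (e n) <> 0.
Proof.
move=> A0; apply/not_existsP => Ae; apply: A0; apply/bopP => x.
have Ax : A (\sum_(0 <= j < n) es j x *: e j) @[n --> \oo] --> A x.
  by apply: bop_cvg; exact: basis_expansion.
apply: (cvg_unique (@norm_hausdorff _ X) Ax).
apply: cvg_near_cst; apply: nearW => n; rewrite linear_sum big1// => k _.
by rewrite linearZ /= (contrapT (Ae k)) scaler0.
Qed.

Lemma positive_basis n : positive_vector es (e n).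
Proof. by move=> m; rewrite es_biorth ler0n. Qed.

Lemma positive_comp S T : positive_operator es S -> positive_operator es T ->
  positive_operator es (bop_comp S T).
Proof. by move=> S0 T0 x x0; apply/S0/T0. Qed.

Lemma positive_iter A n x : positive_operator es A -> positive_vector es x ->
  positive_vector es (iter n A x).
Proof. by move=> A0 x0; elim: n => //= n; exact: A0. Qed.

(** The vector [x - x_m e_m] is still positive: it is [x] with its [m]-th
    coordinate erased. *)
Lemma positive_entry_le A x m n :
  positive_operator es A -> positive_vector es x ->
  (es m x : R[i]) * es n (A (e m)) <= es n (A x).
Proof.
move=> A0 x0; rewrite -subr_ge0.
have -> : (es n (A x) : R[i]) - es m x * es n (A (e m)) =
    es n (A (x - (es m x : R[i]) *: e m)).
  by rewrite !linearB !linearZ.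
apply: A0 => k; rewrite linearB linearZ /= es_biorth.
have [->|_] := eqVneq k m; last by rewrite scaler0 subr0.
by rewrite [_ *: _]mulr1 subrr.
Qed.

Lemma positive_entry_iter A x n m :
  positive_operator es A -> positive_vector es x ->
  (es m x : R[i]) * (es m (A (e m)) : R[i]) ^+ n <= es m (iter n A x).
Proof.
move=> A0 x0; elim: n => [|n IHn]; first by rewrite mulr1.
have := positive_entry_le m m A0 (positive_iter n A0 x0).
rewrite exprSr mulrA; apply: le_trans.
by rewrite ler_wpM2r//; apply/A0/positive_basis.
Qed.

(** The [m]-th coordinate of [A^n x] is at least [x_m * a_mm ^ n], whereas
    quasinilpotence makes [|A^n x|] smaller than every geometric sequence.  As
    the basis need not be unconditional, [0 <= x <= y] does not bound [|x|] in
    terms of [|y|]; hence the comparison is made on a single coordinate, using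
    the continuity of [es m]. *)
Lemma quasinilpotent_entry0 A x m : positive_operator es A ->
  positive_vector es x -> es m x != 0 -> quasinilpotent_at A x ->
  es m (A (e m)) = 0.
Proof.
move=> A0 x0 xm /quasinilpotent_atP Ax.
apply: rnorm_eq0; apply/eqP; rewrite eq_le rnorm_ge0 andbT leNgt; apply/negP.
set b := rnorm _ => b0.
have xm0 : 0 < rnorm (es m x).
  rewrite lt_neqAle rnorm_ge0 andbT eq_sym.
  by apply: contra xm => /eqP/rnorm_eq0->.
have iter_lb n : rnorm (es m x) * b ^+ n <= ropnorm (es m) * rnorm (iter n A x).
  apply: le_trans (rnorm_bop _ _).
  rewrite -lecR rmorphM rmorphXn /= !rnormE -normrX -normrM.
  have b_ge0 : 0 <= (es m (A (e m)) : R[i]) by apply/A0/positive_basis.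
  rewrite !ger0_norm//; last 2 first.
  - exact: positive_iter.
  - by rewrite mulr_ge0 ?exprn_ge0.
  exact: positive_entry_iter.
(* With the ratio [b / 2], the lower bound would give
   [x_m * 2 ^ n <= |es m|] for all large [n]. *)
have /Ax Ax_small : 0 < b / 2 by rewrite divr_gt0.
near \oo => n.
have n_large : ropnorm (es m) / rnorm (es m x) < n%:R.
  by near: n; exact: nbhs_infty_gtr.
have /= Axn : rnorm (iter n A x) <= (b / 2) ^+ n by near: n.
have := le_trans (iter_lb n) (ler_wpM2l (ropnorm_ge0 _) Axn).
rewrite exprMn mulrCA mulrC ler_pM2l ?exprn_gt0// exprVn.
rewrite ler_pdivlMr ?exprn_gt0//.
apply/negP; rewrite -ltNge.
rewrite ltr_pdivrMr// mulrC in n_large; apply: lt_trans n_large _.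
by rewrite ltr_pM2l// -natrX ltr_nat ltn_expl.
Unshelve. all: by end_near.
Qed.

(** The contrapositive of an irreducibility argument: the positivity of all
    entries of [T] spreads the one positive entry [a_kl] of [A] over the whole
    matrix of [T A T], diagonal included. *)
Lemma positive_entries_not_AAB T : positive_operator es T ->
  (forall i j, es i (T (e j)) != 0) -> ~ satisfies_AAB es T.
Proof.
move=> T0 Tij [A [A_neq0 A0 AT [x [x_neq0 x0 Ax]]]].
have [l Al] := neq0_bop_basis A_neq0.
have [k Akl] := neq0_coordinate Al.
have [m xm] := neq0_coordinate x_neq0.
pose B := bop_comp A (bop_comp T T).
have B0 : positive_operator es B by do 2?apply: positive_comp.
have ATy y : A (T y) = T (A y) by move/bopP : AT => /(_ y).
have Bx : quasinilpotent_at B x.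
  apply: quasinilpotent_at_comm Ax.
  by apply/bopP => y /=; rewrite !ATy.
suff : 0 < (es m (B (e m)) : R[i]).
  by rewrite (quasinilpotent_entry0 B0 x0 xm Bx) ltxx.
rewrite /= ATy ATy.
have T_entry_gt0 i j : 0 < (es i (T (e j)) : R[i]).
  by rewrite lt_def Tij; apply/T0/positive_basis.
have ATk_gt0 : 0 < (es k (A (T (e m))) : R[i]).
  apply: lt_le_trans (positive_entry_le l k A0 (T0 _ (positive_basis m))).
  by rewrite mulr_gt0// lt_def Akl; apply/A0/positive_basis.
rewrite -ATy; apply: lt_le_trans (positive_entry_le k m T0 _).
  by rewrite mulr_gt0.
by apply/A0/T0/positive_basis.
Qed.

Lemma sum_inv_exp2_le1 n : \sum_(0 <= k < n) (2 ^- k.+1 : R) <= 1.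
Proof.
suff -> : \sum_(0 <= k < n) (2 ^- k.+1 : R) = 1 - 2 ^- n.
  by rewrite lerBlDr lerDl invr_ge0 exprn_ge0.
elim: n => [|n IHn]; first by rewrite big_geq// expr0 invr1 subrr.
rewrite big_nat_recr//= IHn exprSr invfM; field.
by rewrite expf_neq0.
Qed.

(** [K] is the sum of all matrix units [rank_one (es j) (e i)], enumerated
    through the encoding of pairs and damped so that the [n]-th term has norm at
    most [2 ^- n.+1].  As all terms are positive, the [(i, j)] entry of [K] is
    at least that of the [(i, j)] term. *)
Lemma positive_contraction_entries_exists : exists K : bop X X,
  [/\ positive_operator es K, ropnorm K <= 1 &
      forall i j, es i (K (e j)) != 0].
Proof.
pose unit_of n : bop X X :=
  if unpickle n is Some (i, j) then rank_one (es j) (e i) else 0.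
pose c n : R := 2 ^- n.+1 / (1 + ropnorm (unit_of n)).
have d_gt0 n : 0 < 1 + ropnorm (unit_of n) by rewrite ltr_pwDl// ropnorm_ge0.
have c_gt0 n : 0 < c n by rewrite divr_gt0// invr_gt0 exprn_gt0.
pose U n := (c n)%:C *: unit_of n.
have U_norm n : ropnorm (U n) <= 2 ^- n.+1.
  apply: ropnorm_le => x x1; rewrite /= rnormZ rnorm_realC gtr0_norm//.
  rewrite /c mulrAC ler_pdivrMr// ler_wpM2l ?invr_ge0 ?exprn_ge0//.
  by rewrite (le_trans (ropnorm_ub _ x1))// lerDr.
have U0 n : positive_operator es (U n).
  move=> x x0 i; rewrite /= linearZ /=.
  apply: mulr_ge0; first by rewrite lecR ltW.
  rewrite /unit_of; case: unpickle => [[k l]|]; last by rewrite linear0.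
  by rewrite /= linearZ; apply: mulr_ge0; [exact: x0|exact: positive_basis].
have [K [K1 KU]] : exists K : bop X X, ropnorm K <= 1 /\
    forall x, \sum_(0 <= k < n) U k x @[n --> \oo] --> K x.
  apply: bop_series_exists => n; apply: le_trans (sum_inv_exp2_le1 n).
  by apply: ler_sum.
(* [N = 0] gives the positivity of [K], and [N] just beyond the code of [(i, j)]
   bounds the [(i, j)] entry of [K] from below. *)
have tail_ge0 x i N : positive_vector es x ->
    0 <= (es i (K x - \sum_(0 <= k < N) U k x) : R[i]).
  move=> x0.
  have : es i (\sum_(0 <= k < n + N) U k x - \sum_(0 <= k < N) U k x)
      @[n --> \oo] --> es i (K x - \sum_(0 <= k < N) U k x).
    apply: bop_cvg; apply: cvgB; last exact: cvg_cst.
    by have := KU x; rewrite -(cvg_shiftn N).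
  move=> /cvg_ge0_complex; apply=> n.
  rewrite (big_cat_nat (n := N)) ?leq_addl//= [X in X - _]addrC addrK.
  rewrite linear_sum; apply: sumr_ge0 => k _; exact: U0.
exists K; split=> // [x x0 i|i j].
  by have := tail_ge0 x i 0%N x0; rewrite big_geq// subr0.
pose N := pickle (i, j).
have := tail_ge0 (e j) i N.+1 (positive_basis j).
rewrite linearB /= subr_ge0 => UK; rewrite gt_eqF//; apply: lt_le_trans UK.
rewrite linear_sum big_nat_recr//= ltr_wpDl ?sumr_ge0//.
  by move=> k _; apply/U0/positive_basis.
rewrite linearZ /= /unit_of pickleK linearZ /= !es_biorth !eqxx.
by rewrite !mulr_gt0 ?ltcR ?ltr01.
Qed.

End positivity.

(** * Genericity of operators with no zero entry *)

Section sot_star_genericity.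
Context (R : realType) (X : normedModType R[i]).
Implicit Types (T K : bop X X).

Lemma sot_star_eval_continuous (f : dual X) (y : X) :
  continuous (fun T : sot_star X => f ((T : bop X X) y)).
Proof.
move=> T; have [/(_ cvg_id)[Ty _] _] := sot_star_cvgP T (nbhs_filter T).
have := Ty y; rewrite norm_cvg0P subr_cvg0 => Ty_cvg.
exact: (@bop_cvg _ _ _ f _ _ _
  (fun S : sot_star X => (S : bop X X) y) _ Ty_cvg).
Qed.

Lemma open_eval_neq0 (f : dual X) (y : X) :
  open [set T : sot_star X | f ((T : bop X X) y) != 0].
Proof.
have -> : [set T : sot_star X | f ((T : bop X X) y) != 0] =
    (fun T : sot_star X => f ((T : bop X X) y)) @^-1` (~` [set 0]).
  by apply/seteqP; split=> T /eqP.
apply: open_comp; first by move=> T _; exact: sot_star_eval_continuous.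
apply: closed_openC.
apply: accessible_closed_set1; apply: hausdorff_accessible.
exact: (@norm_hausdorff _ R[i]^o).
Qed.

Definition segment_point T K (t : R) : bop X X :=
  (1 - t)%:C *: T + t%:C *: K.

Lemma segment_pointB T K t : segment_point T K t - T = t%:C *: (K - T).
Proof.
rewrite /segment_point rmorphB /= scalerBl scale1r scalerBr addrAC.
by rewrite [X in X + _]addrAC subrr add0r addrC.
Qed.

(** The differences with [T] are multiples of the fixed vectors [K x - T x] and
    [adjoint K f - adjoint T f] by factors tending to [0], so both halves of the
    strong* topology are handled at once. *)
Lemma segment_point_cvg T K :
  (segment_point T K n.+1%:R^-1 : sot_star X) @[n --> \oo] --> (T : sot_star X).
Proof.
have small (V : normedModType R[i]) (v : V) :
    `|(n.+1%:R^-1)%:C *: v| @[n --> \oo] --> (0 : R[i]^o).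
  rewrite norm_cvg0P; apply/cvg_rnormP => eps eps0; near=> n.
  rewrite sub0r rnormN rnormZ rnorm_realC ger0_norm ?invr_ge0//.
  rewrite mulrC ltr_pdivrMr// -ltr_pdivrMl// mulrC.
  rewrite (@lt_trans _ _ n%:R) ?ltr_nat//.
  by near: n; exact: nbhs_infty_gtr.
apply/sot_star_cvgP; split=> [x|f].
- suff : `|segment_point T K n.+1%:R^-1 x - T x| @[n --> \oo] --> (0 : R[i]^o).
    by [].
  have evalB n : segment_point T K n.+1%:R^-1 x - T x =
      (n.+1%:R^-1)%:C *: (K x - T x).
    exact: (congr1 (fun S : bop X X => S x) (segment_pointB T K _)).
  under eq_fun do rewrite evalB.
  exact: small.
- suff : `|adjoint (segment_point T K n.+1%:R^-1) f - adjoint T f|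
      @[n --> \oo] --> (0 : R[i]^o) by [].
  have adjointB n : adjoint (segment_point T K n.+1%:R^-1) f - adjoint T f =
      (n.+1%:R^-1)%:C *: (adjoint K f - adjoint T f).
    apply/bopP => x; rewrite /=.
    transitivity (f ((segment_point T K n.+1%:R^-1 - T) x)).
      by rewrite [in RHS]/= linearB.
    by rewrite segment_pointB /= linearZ /= linearB.
  under eq_fun do rewrite adjointB.
  exact: small.
Unshelve. all: by end_near.
Qed.

End sot_star_genericity.

Lemma segment_point_positive_contraction (R : realType) (X : normedModType R[i])
    (es : nat -> dual X) (T K : bop X X) (t : R) :
  0 <= t <= 1 -> positive_contractions es T -> positive_contractions es K ->
  positive_contractions es (segment_point T K t).
Proof.
move=> /andP[t0 t1] [T0 T1] [K0 K1]; split.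
  move=> x x0 i; rewrite /= linearD !linearZ /=.
  by rewrite addr_ge0 ?mulr_ge0 ?lecR ?subr_ge0//; [exact: T0|exact: K0].
rewrite (le_trans (ler_normD _ _))// !normrZ !ger0_norm ?lecR ?subr_ge0//.
rewrite (@le_trans _ _ ((1 - t)%:C + t%:C))//.
  by rewrite lerD// ler_piMr// ?lecR ?subr_ge0.
by rewrite -rmorphD /= subrK.
Qed.

(* [positive_contractions es], used as a type, carries the subspace topology
   induced by [sot_star X]. *)
Theorem theorem1p8 (R : realType) (X : completeNormedModType R[i])
    (e : nat -> X) (es : nat -> dual X)
    (X_infinite : infinite_dimensional X)
    (X_reflexive : reflexive_space X)
    (e_basis : schauder_basis e)
    (es_biorthogonal : biorthogonal e es)
    (e_monotone : monotone_basis e es) :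
  comeager [set T : positive_contractions es | ~ satisfies_AAB es (set_val T)].
Proof.
(* [F] enumerates the open conditions, one per pair [(i, j)]; integers that
   encode no pair impose no condition. *)
pose F n := [set T : positive_contractions es |
  if unpickle n is Some (i, j) then es i ((set_val T : bop X X) (e j)) != 0
  else True].
have FP (T : positive_contractions es) : (\bigcap_n F n) T <->
    forall i j, es i ((set_val T : bop X X) (e j)) != 0.
  split=> [FT i j|Tij n _]; last first.
    by rewrite /F /=; case: unpickle => // -[i j]; exact: Tij.
  by have := FT (pickle (i, j)) I; rewrite /F /= pickleK.
exists (\bigcap_n F n); split.
- exists F => // n; rewrite /F; case: unpickle => [[i j]|]; last exact: openT.
  have := open_eval_neq0 (es i) (e j).
  by move=> oij; exists [set T : sot_star X | es i ((T : bop X X) (e j)) != 0].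
- move=> O [T OT] [U oU UO].
  have [K [K0 K1 Kij]] :=
    positive_contraction_entries_exists es_biorthogonal.
  have UT : nbhs (set_val T : sot_star X) U.
    by apply: open_nbhs_nbhs; split=> //; rewrite -UO in OT.
  have [N _ /(_ N (leqnn N)) /= UN] := segment_point_cvg K UT.
  have SP : positive_contractions es
      (segment_point (set_val T : bop X X) K N.+1%:R^-1).
    apply: segment_point_positive_contraction.
    - by rewrite invr_ge0 ler0n invf_le1 ?ler1n ?ltr0n.
    - exact: set_valP.
    - by split=> //; rewrite -[1]/(1%:C) lecR.
  exists (SigSub (mem_set SP)); split; first by rewrite -UO.
  apply/FP => i j; rewrite /= linearD !linearZ /=.
  rewrite gt_eqF//.
  have [T0 _] := set_valP T.
  apply: ltr_wpDl.
    apply: mulr_ge0; last by apply/T0/positive_basis.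
    by rewrite lecR subr_ge0 invf_le1 ?ler1n ?ltr0n.
  rewrite mulr_gt0 ?ltcR ?invr_gt0 ?ltr0n//.
  by rewrite lt_def Kij; apply/K0/positive_basis.
- move=> T /FP Tij.
  apply: (positive_entries_not_AAB e_basis es_biorthogonal) Tij.
  by have [] := set_valP T.
Qed.
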